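(* Let $\varphi$ be a renormalization of the finitely generated group $\Gamma$, and let $\widehat{\varphi} \colon \widehat{\Gamma}_{\varphi} \to \widehat{\Gamma}_{\varphi}$ be the injective homomorphism induced by $\varphi$. Then the discriminant group satisfies $$\mathcal{D}_{\varphi} = \bigcap_{n > 0} \widehat{\varphi}^{\,n}(\widehat{\Gamma}_{\varphi}).$$
   Context: A renormalization of a countable group $\Gamma$ is an injective homomorphism $\varphi\colon\Gamma\to\Gamma$ whose image is a proper subgroup of finite index. Put $\Gamma_0=\Gamma$, $\Gamma_\ell=\varphi^\ell(\Gamma)$, $X_\ell=\Gamma/\Gamma_\ell$ (left cosets), and let $X_\varphi=\varprojlim X_\ell$ be the inverse limit under the natural quotient maps $X_{\ell+1}\to X_\ell$; it is a Cantor space. The left translation actions of $\Gamma$ on the $X_\ell$ induce a minimal equicontinuous action $\Phi_\varphi\colon\Gamma\to\mathrm{Homeo}(X_\varphi)$. Let $\widehat{\Gamma}_\varphi$ be the closure of $\Phi_\varphi(\Gamma)$ in $\mathrm{Homeo}(X_\varphi)$ in the uniform topology; it is a profinite group acting on $X_\varphi$. Let $x_\varphi=(e\Gamma_\ell)_{\ell\ge 0}\in X_\varphi$. The discriminant group is $\mathcal{D}_\varphi=\{\widehat g\in\widehat\Gamma_\varphi \mid \widehat g\, x_\varphi=x_\varphi\}$. When $\Gamma$ is finitely generated there is a unique continuous homomorphism $\widehat\varphi\colon\widehat\Gamma_\varphi\to\widehat\Gamma_\varphi$ with $\widehat\varphi(\Phi_\varphi(g))=\Phi_\varphi(\varphi(g))$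 for all $g\in\Gamma$; it is injective with clopen image, and is called the map induced by $\varphi$. *)

(* Defs.v *)
From HB Require Import structures.
From mathcomp Require Import all_boot all_classical topology.

Set Implicit Arguments.
Unset Strict Implicit.
Unset Printing Implicit Defensive.

Local Open Scope quotient_scope.
Local Open Scope classical_set_scope.
Local Open Scope group_scope.

Section LeftCosets.
Context {G : groupType}.
Implicit Types H K : groupClosed G.

Definition finitely_generated : Prop :=
  exists s : seq G, forall H, {subset s <= H} -> forall g, g \in H.

Definition left_coset_rel H : rel G := fun g h => g^-1 * h \in H.

Lemma left_coset_rel_refl H : reflexive (left_coset_rel H).
Proof. by move=> g; rewrite /left_coset_rel mulVg gpred1. Qed.

Lemma left_coset_rel_sym H : symmetric (left_coset_rel H).
Proof. by move=> g h; rewrite /left_coset_rel -gpredV invgM invgK. Qed.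

Lemma left_coset_rel_trans H : transitive (left_coset_rel H).
Proof.
move=> h g k gh hk; rewrite /left_coset_rel.
by rewrite -[k](mulVKg h) mulgA gpredM.
Qed.

Canonical left_coset_equiv H := EquivRel (left_coset_rel H)
  (left_coset_rel_refl H) (left_coset_rel_sym H) (@left_coset_rel_trans H).

Definition left_cosets H := {eq_quot (left_coset_rel H)}.

Definition finite_index H : Prop := finite_set [set: left_cosets H].

Definition translate H (g : G) (x : left_cosets H) : left_cosets H :=
  \pi_(left_cosets H) (g * repr x).

(* Meaningful only when K is contained in H, see quotient_mapE. *)
Definition quotient_map H K (x : left_cosets K) : left_cosets H :=
  \pi_(left_cosets H) (repr x).

Lemma left_cosetsP H g h :
  reflect (\pi_(left_cosets H) g = \pi_(left_cosets H) h) (g^-1 * h \in H).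
Proof. exact: (iffP (@eqquotP _ _ (left_cosets H) g h)). Qed.

Lemma repr_left_coset H g :
  g^-1 * repr (\pi_(left_cosets H) g) \in H.
Proof. by apply/left_cosetsP; rewrite reprK. Qed.

Lemma translateE H g h :
  translate g (\pi_(left_cosets H) h) = \pi_(left_cosets H) (g * h).
Proof.
apply/esym/left_cosetsP; rewrite invgM -mulgA mulKg.
exact: repr_left_coset.
Qed.

Lemma quotient_mapE H K g : {subset K <= H} ->
  quotient_map H (\pi_(left_cosets K) g) = \pi_(left_cosets H) g.
Proof. by move=> KH; apply/esym/left_cosetsP/KH/repr_left_coset. Qed.

Lemma quotient_map_translate H K g (x : left_cosets K) : {subset K <= H} ->
  quotient_map H (translate g x) = translate g (quotient_map H x).
Proof.
by move=> KH; rewrite -[x]reprK translateE !quotient_mapE ?translateE.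
Qed.

End LeftCosets.

Arguments finitely_generated : clear implicits.

Definition homeomorphisms (X : topologicalType) : set (X -> X) :=
  [set f | continuous f /\
     exists f' : X -> X, [/\ continuous f', cancel f f' & cancel f' f]].
Arguments homeomorphisms : clear implicits.

Section Renormalization.
Context {G : groupType}.
Implicit Type phi : {multiplicative G -> G}.

Definition chain phi (l : nat) : {pred G} := mem (range (iter l phi)).

Lemma chainP phi l g :
  reflect (exists h, iter l phi h = g) (g \in chain phi l).
Proof.
by apply: (iffP idP) => [/set_mem[h _ <-]|[h <-]]; [exists h|apply/mem_set].
Qed.

Lemma iter_multiplicative phi l : {morph iter l phi : g h / g * h}.
Proof. by move=> g h; elim: l => //= l ->; rewrite gmulfM. Qed.

Lemma iter_one phi l : iter l phi 1 = 1.
Proof.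
by apply: (@mulgI _ (iter l phi 1)); rewrite -iter_multiplicative !mulg1.
Qed.

Lemma chain_mulg_closed phi l : mulg_closed (chain phi l).
Proof.
move=> _ _ /chainP[g <-] /chainP[h <-]; apply/chainP; exists (g * h).
exact: iter_multiplicative.
Qed.

Lemma chain_one phi l : 1 \in chain phi l.
Proof. by apply/chainP; exists 1; exact: iter_one. Qed.

Lemma chain_invg_closed phi l : invg_closed (chain phi l).
Proof.
move=> _ /chainP[g <-]; apply/chainP; exists g^-1.
apply: (@mulgI _ (iter l phi g)).
by rewrite -iter_multiplicative !mulgV iter_one.
Qed.

HB.instance Definition _ phi l :=
  isMulClosed.Build G (chain phi l) (@chain_mulg_closed phi l).
HB.instance Definition _ phi l :=
  isMul1Closed.Build G (chain phi l) (chain_one phi l).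
HB.instance Definition _ phi l :=
  isInvClosed.Build G (chain phi l) (@chain_invg_closed phi l).

Lemma chainS phi l : {subset chain phi l.+1 <= chain phi l}.
Proof.
by move=> _ /chainP[g <-]; apply/chainP; exists (phi g); rewrite -iterSr.
Qed.

(* [chain phi 1] is the image of phi. *)
Definition renormalization phi : Prop :=
  [/\ injective phi, range phi <> [set: G] & finite_index (chain phi 1)].

Definition level phi (l : nat) : uniformType :=
  discrete_topology (left_cosets (chain phi l)).

Definition coherent phi : set (prod_topology (level phi)) :=
  [set x | forall l, quotient_map (chain phi l) (x l.+1) = x l].
Arguments coherent : clear implicits.

(* The inverse limit, with the subspace uniformity of the product of the
   discrete spaces [level phi l]. *)
Definition inverse_limit phi : uniformType := set_type (coherent phi).

Lemma base_point_coherent phi :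
  coherent phi (fun l => \pi_(left_cosets (chain phi l)) 1).
Proof. by move=> l; rewrite quotient_mapE//; exact: chainS. Qed.

Definition base_point phi : inverse_limit phi :=
  SigSub (mem_set (base_point_coherent phi)).

Lemma action_coherent phi (g : G) (x : inverse_limit phi) :
  coherent phi (fun l => translate g (val x l)).
Proof.
move=> l; rewrite quotient_map_translate; last exact: chainS.
by rewrite (set_mem (valP x)).
Qed.

Definition action phi (g : G) (x : inverse_limit phi) : inverse_limit phi :=
  SigSub (mem_set (action_coherent g x)).

(* Self-maps of the inverse limit, with the topology of uniform convergence. *)
Definition self_maps phi : uniformType :=
  arrow_uniform_type (inverse_limit phi) (inverse_limit phi).

(* The closure of the image of the action relative to the space of
   homeomorphisms. *)
Definition completion phi : set (self_maps phi) :=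
  homeomorphisms (inverse_limit phi) `&`
  closure (range (@action phi) : set (self_maps phi)).
Arguments completion : clear implicits.

Definition discriminant phi : set (self_maps phi) :=
  [set f | completion phi f /\ f (base_point phi) = base_point phi].
Arguments discriminant : clear implicits.

(* [hphi] is, on [completion phi], a continuous group endomorphism extending
   phi; its values outside of [completion phi] are irrelevant. *)
Definition induced_map phi (hphi : self_maps phi -> self_maps phi) : Prop :=
  [/\ set_fun (completion phi) (completion phi) hphi,
      {within completion phi, continuous hphi},
      forall f f', completion phi f -> completion phi f' ->
        hphi (f \o f') = hphi f \o hphi f'
    & forall g, hphi (action g) = action (phi g)].

End Renormalization.
Arguments completion {G} phi _.
Arguments discriminant {G} phi _.

(* Main.v *)
Require Import Defs.
From HB Require Import structures.
From mathcomp Require Import all_boot all_classical topology.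

Set Implicit Arguments.
Unset Strict Implicit.
Unset Printing Implicit Defensive.

(** Elements of the completion are controlled one level at a time.  The
    uniformity of the inverse limit X is generated by the relations `same
    coordinate at level l' ([entourage_levelP]), so convergence in [self_maps]
    and membership in the closure of G amount to agreement at every level
    ([cvg_levelP], [closure_levelP]).  If f agrees with the action of g at
    level n, then f fixes the n-th coordinate of the base point exactly when g
    lies in phi^n(G) ([base_point_stable]).

    An element f = hphi^n(f') of the n-th image is a limit of the elements
    phi^n(g) of G as g tends to f', so f fixes the base point up to level n
    ([induced_image_fixes_level]); an element of all the
    images therefore lies in the discriminant.

    Conversely, let f fix the base point.  For each n it is then a limit of
    elements of phi^n(G), say of phi^n(g) along some filter of elements g.  The
    levels are finite, so the completion is compact: along a finer ultrafilter
    the elements g converge to some f' in the completion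
    ([completion_compact]).  By continuity hphi^n(f') is also the limit of the
    phi^n(g), hence equal to f ([discriminant_sub_induced_image]). *)

Local Open Scope quotient_scope.
Local Open Scope classical_set_scope.

(** * Ultrafilters and maps to finite types *)

Lemma finite_near_forall (T : Type) (I : choiceType) (F : set_system T)
    (P : I -> set T) : Filter F -> finite_set [set: I] ->
  (forall i, F (P i)) -> F [set t | forall i, P i t].
Proof.
move=> FF /finite_fsetP[D DT] FP.
apply: filterS (filter_bigI (D := D) (f := P) _ _) => // t Pt i.
by apply: Pt; rewrite -DT.
Qed.

Lemma ultra_finite_constant (T : Type) (I : choiceType) (U : set_system T)
    (u : T -> I) : UltraFilter U -> finite_set [set: I] ->
  exists i, U [set t | u t = i].
Proof.
move=> UU finI; apply: contrapT => /forallNP nU.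
have : U [set t | forall i, u t <> i].
  apply: finite_near_forall => // i.
  by have [/nU|] := in_ultra_setVsetC [set t | u t = i] UU.
by move=> /filter_ex[t /(_ (u t))].
Qed.

(** * Levels of the inverse limit *)

Lemma translateK (G : groupType) (H : groupClosed G) (g : G) :
  cancel (@translate G H g) (translate g^-1%g).
Proof.
by move=> c; rewrite [translate g c]/translate translateE mulKg reprK.
Qed.

Section Levels.
Local Open Scope group_scope.
Context {G : groupType}.
Variable phi : {multiplicative G -> G}.
Implicit Types (x y : inverse_limit phi) (f : self_maps phi).

(** If a runs through representatives of G / phi^l(G) and b through
    representatives of G / phi(G), the products a * phi^l(b) represent every
    coset of phi^(l+1)(G). *)
Lemma finite_level l : finite_index (chain phi 1) ->
  finite_set [set: level phi l].
Proof.
move=> fin1; elim: l => [|l IHl].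
  (* [chain phi 0] is all of G, so level 0 is a point. *)
  apply: sub_finite_set (finite_set1 (\pi_(left_cosets (chain phi 0)) 1)).
  move=> x _ /=; rewrite -[x]reprK; apply/left_cosetsP.
  by apply/chainP; exists ((repr x)^-1 * 1).
pose c (ab : level phi l * left_cosets (chain phi 1)) :=
  \pi_(left_cosets (chain phi l.+1)) (repr ab.1 * iter l phi (repr ab.2)).
apply: sub_finite_set (finite_image c (finite_setX IHl fin1)) => x _.
have /chainP[h hE] : (repr (\pi_(left_cosets (chain phi l)) (repr x)))^-1
    * repr x \in chain phi l.
  by rewrite -gpredV invgM invgK; exact: repr_left_coset.
have /chainP[k kE] : (repr (\pi_(left_cosets (chain phi 1)) h))^-1 * h
    \in chain phi 1.
  by rewrite -gpredV invgM invgK; exact: repr_left_coset.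
exists (\pi_(left_cosets (chain phi l)) (repr x),
        \pi_(left_cosets (chain phi 1)) h) => //.
rewrite -[RHS]reprK; apply/left_cosetsP/chainP; exists k.
rewrite iterSr; move: kE => /= ->.
rewrite iter_multiplicative hE invgM -mulgA; congr (_ * _).
by apply: (@mulgI _ (iter l phi (repr (\pi_(left_cosets (chain phi 1)) h))));
  rewrite -iter_multiplicative !mulgV iter_one.
Qed.

Lemma coordinate_le l m x y : (l <= m)%N ->
  \val x m = \val y m -> \val x l = \val y l.
Proof.
move=> lm; rewrite -(subnK lm) addnC; elim: (m - l)%N => [|n IHn].
  by rewrite addn0.
rewrite addnS => xy; apply: IHn.
by rewrite -(set_mem (valP x)) -(set_mem (valP y)) xy.
Qed.

Lemma coordinates_inj x y : (forall l, \val x l = \val y l) -> x = y.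
Proof. by move=> xy; apply: val_inj; exact: functional_extensionality_dep. Qed.

(** An entourage of the product constrains only finitely many coordinates; on
    coherent sequences they are all determined by the one of largest index. *)
Lemma entourage_levelP (E : set (inverse_limit phi * inverse_limit phi)) :
  entourage E <-> exists l, forall x y, \val x l = \val y l -> E (x, y).
Proof.
split=> [[V [W [D _ <-] DV] VE]|[l lE]].
  exists (\max_(p <- finmap.enum_fset D) (projT1 p).1)%N => x y xy.
  apply: VE; apply: DV => p pD /=.
  have := @leq_bigmax_seq _ (finmap.enum_fset D) xpredT
    (fun p => (projT1 p).1) p pD isT.
  case: p pD => [[/= i A] Aent] pD /= iD; have /asboolP[B entB BA] := Aent.
  apply: BA; change (B (\val x i, \val y i)).
  by rewrite (coordinate_le iD xy); exact: entourage_refl.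
(* Conversely, equality at level l is the pullback of a discrete entourage
   along a single projection. *)
pose same := [set xy : prod_topology (level phi) * prod_topology (level phi)
  | xy.1 l = xy.2 l].
exists same; last by move=> [x y] /= /lE.
have same_l : `[< @entourage (initial_topology (@proj _ (level phi) l))
    same >].
  apply/asboolP.
  exists [set ab : level phi l * level phi l | ab.1 = ab.2] => //.
  by rewrite uniform_discrete => _ [a _ <-].
exists same => //.
pose p0 : {p : {classic nat} * set (prod_topology (level phi) *
    prod_topology (level phi)) | `[< @entourage
      (initial_topology (@proj _ (level phi) p.1)) p.2 >]} :=
  exist _ (@pair {classic nat} _ l same) same_l.
exists (finmap.fset1 p0); first by move=> p _; exact: in_setT.
apply/seteqP; split=> [xy /(_ p0)|xy sxy p /=].
  by apply; exact/finmap.fset1P.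
by move/finmap.fset1P => ->.
Qed.

(** * Agreement of self-maps at a level *)

Definition agree l f f' := forall x, \val (f x) l = \val (f' x) l.

Lemma agree_le l m f f' : (l <= m)%N -> agree m f f' -> agree l f f'.
Proof. by move=> lm ff' x; exact: coordinate_le lm (ff' x). Qed.

Lemma agree_eq f f' : (forall l, agree l f f') -> f = f'.
Proof.
by move=> ff'; apply/funext => x; apply: coordinates_inj => l; exact: ff'.
Qed.

Lemma cvg_levelP (F : set_system (self_maps phi)) f : Filter F ->
  F --> f <-> forall l, F [set f' | agree l f f'].
Proof.
move=> FF; split=> [/cvg_fct_entourageP Ff l|Ff].
  by apply: (Ff [set xy | \val xy.1 l = \val xy.2 l]);
    apply/entourage_levelP; exists l.
apply/cvg_fct_entourageP => E /entourage_levelP[l lE].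
by apply: filterS (Ff l) => f' ff' x; apply: lE; exact: ff'.
Qed.

Lemma closure_levelP (S : set (self_maps phi)) f :
  closure S f <-> forall l, exists2 f', S f' & agree l f f'.
Proof.
split=> [cSf l|agSf B].
  have /cvg_levelP/(_ l) fl : nbhs f --> f by [].
  by have [f' [Sf' ff']] := cSf _ fl; exists f'.
move=> /nbhsP[E [V /entourage_levelP[l lV] VE] EB].
have [f' Sf' ff'] := agSf l; exists f'; split=> //.
by apply: EB; apply/mem_set/VE => x /=; apply: lV; exact: ff'.
Qed.

(** The action of g at level l is computed inside level l, so the same holds
    for any map that agrees with it there. *)
Lemma agree_action_coordinate l f g x y : agree l f (action g) ->
  \val x l = \val y l -> \val (f x) l = \val (f y) l.
Proof. by move=> fg xy; rewrite !fg /= xy. Qed.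

Lemma agree_action_continuous f :
  (forall l, exists g, agree l f (action g)) -> continuous f.
Proof.
move=> fg x B /nbhsP[E /entourage_levelP[l lE] EB]; apply/nbhsP.
exists [set xy | \val xy.1 l = \val xy.2 l].
  by apply/entourage_levelP; exists l.
move=> y /xsectionP xy; apply: EB; apply/xsectionP/lE.
by have [g fg'] := fg l; exact: agree_action_coordinate fg' xy.
Qed.

Lemma completion_levels f f' : cancel f f' -> cancel f' f ->
  (forall l, exists g, agree l f (action g)) ->
  (forall l, exists g, agree l f' (action g)) -> completion phi f.
Proof.
move=> ff' f'f fg f'g; split.
  by split; [|exists f'; split=> //]; exact: agree_action_continuous.
by apply/closure_levelP => l; have [g ?] := fg l; exists (action g).
Qed.

Lemma actionK g : cancel (@action _ phi g) (action g^-1).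
Proof.
by move=> x; apply: coordinates_inj => l /=; exact: translateK.
Qed.

Lemma completion_action g : completion phi (action g).
Proof.
apply: (@completion_levels (action g) (action g^-1)).
- exact: actionK.
- by have := actionK g^-1; rewrite invgK.
- by exists g.
- by exists g^-1.
Qed.

(** * Compactness of the completion *)

(** The permutation of the finite level l induced by a g is constant along U
    (for each l); these constant values form the limit map.  The map [a] is
    there so that the limit of the inverses can be taken along the same U. *)
Lemma ultra_limit (U : set_system G) (a : G -> G) :
  UltraFilter U -> finite_index (chain phi 1) ->
  exists f, forall l, U [set g | agree l f (action (a g))].
Proof.
move=> UU fin1.
have lim l (c : level phi l) : {d | U [set g | translate (a g) c = d]}.
  by apply/cid/ultra_finite_constant/finite_level.
pose T l c := projT1 (lim l c).
have TU l : U [set g | forall c, translate (a g) c = T l c].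
  apply: finite_near_forall; first exact: finite_level.
  by move=> c; exact: (projT2 (lim l c)).
have Tx x : @coherent _ phi (fun l => T l (\val x l)).
  move=> l; have [g [gl gSl]] := filter_ex (filterI (TU l) (TU l.+1)).
  by rewrite -gl -gSl; exact: action_coherent.
exists (fun x => SigSub (mem_set (Tx x))) => l.
by apply: filterS (TU l) => g gT x /=; rewrite gT.
Qed.

(** The limit of the inverses along U is inverse to the limit along U, because
    at each level some g realizes both; hence the limit is a homeomorphism. *)
Lemma completion_compact (U : set_system G) :
  UltraFilter U -> finite_index (chain phi 1) ->
  exists2 f, completion phi f & forall l, U [set g | agree l f (action g)].
Proof.
move=> UU fin1.
have [f fU] := ultra_limit id UU fin1.
have [f' f'U] := ultra_limit (fun g => g^-1) UU fin1.
exists f => //; apply: (@completion_levels _ f') => [x|x|l|l].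
- apply: coordinates_inj => l.
  have [g [fg f'g]] := filter_ex (filterI (fU l) (f'U l)).
  by rewrite f'g /= fg; exact: translateK.
- apply: coordinates_inj => l.
  have [g [fg f'g]] := filter_ex (filterI (fU l) (f'U l)).
  by rewrite fg /= f'g; have := translateK g^-1; rewrite invgK; exact.
- by have [g] := filter_ex (fU l); exists g.
- by have [g] := filter_ex (f'U l); exists g^-1.
Qed.

(** The trace on G, through u, of the neighborhoods of f. *)
Definition approximations (u : G -> self_maps phi) f : set_system G :=
  filter_from setT (fun l => [set g | agree l f (u g)]).

Lemma approximations_proper u f : (forall l, exists g, agree l f (u g)) ->
  ProperFilter (approximations u f).
Proof.
move=> fu; apply: filter_from_proper => [|l _]; last exact: fu.
apply: filter_from_filter; first by exists 0%N.
move=> l m _ _; exists (maxn l m) => // g fg; split; apply: agree_le fg.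
  exact: leq_maxl.
exact: leq_maxr.
Qed.

(** * Iterates of the induced map *)

Lemma base_point_stable n f g :
  agree n f (action g) ->
  \val (f (base_point phi)) n = \val (base_point phi) n <-> g \in chain phi n.
Proof.
move=> fg; rewrite fg /= translateE mulg1; split=> [/esym/left_cosetsP|gn].
  by rewrite invg1 mul1g.
by apply/esym/left_cosetsP; rewrite invg1 mul1g.
Qed.

Implicit Type hphi : self_maps phi -> self_maps phi.

Lemma iter_induced_completion hphi n f : induced_map hphi ->
  completion phi f -> completion phi (iter n hphi f).
Proof. by move=> [homc _ _ _] cf; elim: n => //= n /homc. Qed.

(** Continuity of hphi and its values on G are used one step at a time: hphi is
    continuous only within the completion, where all these elements stay. *)
Lemma iter_induced_limit hphi n (F : set_system G) {FF : Filter F} f :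
  induced_map hphi -> completion phi f ->
  (forall l, F [set g | agree l f (action g)]) ->
  forall l, F [set g | agree l (iter n hphi f) (action (iter n phi g))].
Proof.
move=> hphiP cf fF; elim: n => // n IHn.
have [_ + _ hphi_action] := hphiP.
move=> /subspace_continuousP.
move=> /(_ _ (iter_induced_completion n hphiP cf)) cvg_hphi.
pose u g : self_maps phi := action (iter n phi g).
have uF : u @ F --> iter n hphi f by apply/cvg_levelP.
have : hphi \o u @ F --> iter n.+1 hphi f.
  apply: cvg_comp cvg_hphi => A.
  rewrite /within /= => /uF uA.
  apply: (@filterS _ F _ _ _ _ uA) => g; apply.
  exact: completion_action.
move=> /cvg_levelP lim l; apply: (@filterS _ F _ _ _ _ (lim l)) => g /=.
by rewrite hphi_action.
Qed.

Lemma discriminant_sub_induced_image hphi n :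
  induced_map hphi -> finite_index (chain phi 1) ->
  discriminant phi `<=` iter n hphi @` completion phi.
Proof.
move=> hphiP fin1 f [[_ /closure_levelP fcl] fx].
have : ProperFilter (approximations (fun g => action (iter n phi g)) f).
  apply: approximations_proper => l.
  (* An approximation at a level at least n also fixes the base point at level
     n, which places it in phi^n(G). *)
  have [_ [g _ <-] fg] := fcl (maxn l n).
  have /chainP[h hg] : g \in chain phi n.
    by apply/(base_point_stable (agree_le (leq_maxr l n) fg)); rewrite fx.
  by exists h; rewrite hg; exact: agree_le (leq_maxl l n) fg.
move=> /ultraFilterLemma[U [UU fU]].
have [f' cf' f'U] := completion_compact UU fin1.
exists f' => //; apply: agree_eq => l.
have fUl : U [set g | agree l f (action (iter n phi g))].
  by apply: fU; exists l.
have [g [fg f'g]] :=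
  filter_ex (filterI fUl (iter_induced_limit n hphiP cf' f'U l)).
by move=> x; rewrite f'g fg.
Qed.

Lemma induced_image_fixes_level hphi n f :
  induced_map hphi -> (iter n hphi @` completion phi) f ->
  \val (f (base_point phi)) n = \val (base_point phi) n.
Proof.
move=> hphiP [f' cf' <-]; have [_ /closure_levelP f'cl] := cf'.
have FF : ProperFilter (approximations (@action _ phi) f').
  by apply: approximations_proper => m; have [_ [g _ <-]] := f'cl m; exists g.
have f'F m : approximations (@action _ phi) f' [set g | agree m f' (action g)].
  by exists m.
have [h fh] := filter_ex (iter_induced_limit n hphiP cf' f'F n).
by apply/(base_point_stable fh)/chainP; exists h.
Qed.

End Levels.

Theorem theorem1p4 (G : groupType) (phi : {multiplicative G -> G})
    (hphi : self_maps phi -> self_maps phi) :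
  finitely_generated G -> renormalization phi -> induced_map hphi ->
  discriminant phi =
    \bigcap_(n in [set n : nat | (0 < n)%N]) (iter n hphi @` completion phi).
Proof.
move=> _ [_ _ fin1] hphiP; apply/seteqP; split=> [f Df n _|f fimg].
  exact: discriminant_sub_induced_image Df.
split.
  have [f1 cf1 <-] := fimg 1%N isT.
  exact: (iter_induced_completion 1 hphiP).
(* Level l is read off from level l.+1, since 0 is not among the indices n. *)
apply: coordinates_inj => l; apply: (coordinate_le (leqnSn l)).
exact: induced_image_fixes_level hphiP (fimg l.+1 isT).
Qed.
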